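(* Let $(X,\tau)$ be a topological space and let $\mathfrak a_1,\mathfrak a_2:X\to\tau$ be scope functions with $\mathfrak a_2\sqsubseteq\mathfrak a_1$, i.e. $\mathfrak a_2(x)\subseteq\mathfrak a_1(x)$ for every $x\in X$. Then (a) $R_{\mathfrak a_2}\subseteq R_{\mathfrak a_1}$ and $\preccurlyeq_{\mathfrak a_2}\,\subseteq\,\preccurlyeq_{\mathfrak a_1}$; (b) $\tau_{\mathfrak a_1}\subseteq\tau_{\mathfrak a_2}$; (c) $K_{\mathfrak a_2}(A)\subseteq K_{\mathfrak a_1}(A)$ for every $A\subseteq X$; (d) $\equiv_{\mathfrak a_2}\ \subseteq\ \equiv_{\mathfrak a_1}$ as equivalence relations on $\mathcal P(X)$.
   Context: $X$ is a nonempty set. A scope function on $(X,\tau)$ is a map $\mathfrak a:X\to\tau$ with $x\in\mathfrak a(x)$ for every $x\in X$. For a scope function $\mathfrak a$: a set $U\subseteq X$ is $\mathfrak a$-open if $\{x\in U:\mathfrak a(x)\subseteq U\}=U$; the family of all $\mathfrak a$-open sets is denoted $\tau_{\mathfrak a}$ and is known to be a topology on $X$. The scope relation is $xR_{\mathfrak a}y\iff y\in\mathfrak a(x)$, and $\preccurlyeq_{\mathfrak a}$ is its reflexive-transitive closure. For $A,B\subseteq X$, $A\equiv_{\mathfrak a}B$ means that for every $U\in\tau_{\mathfrak a}$, $A\subseteq U\iff B\subseteq U$. The canonical hull is $K_{\mathfrak a}(A)=\bigcap\{U\in\tau_{\mathfrak a}:A\subseteq U\}$. *)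

(* Defs.v *)
From Stdlib Require Export Relations.
From mathcomp Require Export all_boot all_order.
From mathcomp Require Export boolp classical_sets topology.

Set Implicit Arguments.
Unset Strict Implicit.
Unset Printing Implicit Defensive.

Local Open Scope classical_set_scope.

(** The topology tau is the one carried by [X : topologicalType]; a map
    X -> tau is a map into [set X] all of whose values are open. *)
Record scope_function (X : topologicalType) := ScopeFunction {
  scope :> X -> set X ;
  scope_open : forall x, open (scope x) ;
  scope_mem : forall x, scope x x }.

Section Scope.
Variables (X : topologicalType) (a : scope_function X).

Definition scope_topology : set (set X) :=
  [set U | [set x | U x /\ a x `<=` U] = U].

Definition scope_rel : relation X := fun x y => a x y.

Definition scope_preorder : relation X := clos_refl_trans X scope_rel.

Definition scope_equiv : relation (set X) := fun A B =>
  forall U, scope_topology U -> (A `<=` U <-> B `<=` U).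

Definition canonical_hull (A : set X) : set X :=
  \bigcap_(U in [set U | scope_topology U /\ A `<=` U]) U.

Lemma scope_topologyP (U : set X) :
  scope_topology U <-> forall x, U x -> a x `<=` U.
Proof.
split=> [UE x Ux|aU]; last by apply/seteqP; split=> x; [case | split; auto].
by have [] : [set x | U x /\ a x `<=` U] x by rewrite UE.
Qed.

Lemma scope_topologyT : scope_topology setT.
Proof. by apply/scope_topologyP. Qed.

Lemma scope_topologyI (U V : set X) :
  scope_topology U -> scope_topology V -> scope_topology (U `&` V).
Proof.
move=> /scope_topologyP aU /scope_topologyP aV; apply/scope_topologyP.
by move=> x [Ux Vx] y axy; split; [exact: aU axy | exact: aV axy].
Qed.

Lemma scope_topology_bigcup (I : Type) (D : set I) (F : I -> set X) :
  (forall i, D i -> scope_topology (F i)) ->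
  scope_topology (\bigcup_(i in D) F i).
Proof.
move=> aF; apply/scope_topologyP => x [i Di Fix] y axy; exists i => //.
by have /scope_topologyP := aF i Di; apply; eauto.
Qed.

Lemma scope_equiv_equivalence : equivalence (set X) scope_equiv.
Proof.
split=> [A U _ //|A B C AB BC U aU|A B AB U aU].
- by rewrite (AB U aU); exact: BC.
- by split; apply AB.
Qed.

End Scope.

(* Main.v *)
Require Import Defs.

Local Open Scope classical_set_scope.

(** Shrinking the scopes removes arrows from the scope relation, hence also
    from its reflexive-transitive closure, which is monotone.  A set is
    open for a scope function exactly when it is closed under these arrows.
    Fewer arrows impose fewer closure conditions, so there are more open sets
    ([scope_topology_antitone]).  The hull and the equivalence see the scope
    function only through its open sets: the hull intersects over a larger
    family, and equivalent sets have to agree on more tests. *)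

Lemma scope_topology_antitone (X : topologicalType) (a1 a2 : scope_function X) :
  (forall x : X, a2 x `<=` a1 x) -> scope_topology a1 `<=` scope_topology a2.
Proof.
move=> a21 U /scope_topologyP a1U; apply/scope_topologyP => x Ux.
exact: subset_trans (a21 x) (a1U x Ux).
Qed.

Theorem theorem7p2 (X : topologicalType) (X_nonempty : [set: X] !=set0)
  (a1 a2 : scope_function X) (a2_sub_a1 : forall x : X, a2 x `<=` a1 x) :
  (inclusion X (scope_rel a2) (scope_rel a1) /\
   inclusion X (scope_preorder a2) (scope_preorder a1)) /\
  scope_topology a1 `<=` scope_topology a2 /\
  (forall A : set X, canonical_hull a2 A `<=` canonical_hull a1 A) /\
  inclusion (set X) (scope_equiv a2) (scope_equiv a1).
Proof.
have rel21 : inclusion X (scope_rel a2) (scope_rel a1).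
  by move=> x y; exact: a2_sub_a1.
have top12 := @scope_topology_antitone _ _ _ a2_sub_a1.
split; [split=> // x y | split=> //; split].
- elim=> [u v /rel21|u|u v w _ uv _ vw]; first exact: rt_step.
    exact: rt_refl.
  exact: rt_trans uv vw.
- by move=> A x hull2 U [/top12 oU AU]; exact: hull2.
- by move=> A B AB U /top12; exact: AB.
Qed.
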